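(* Let $F_c:\mathbb{R}^n\to\mathbb{R}^n$ be the smoothed function defined in the context, and let $x^*$ be a solution of the system $F_c(x)=0$. For real parameters $\xi_1,\xi_2$ define the sequence $$\begin{cases} y^k=x^k\pm\xi_1F_c'(x^k)^{-1}F_c(x^k),\\ x^{k+1}=y^k-\xi_2F_c'(x^k)^{-1}F_c(y^k),\end{cases}\qquad k=0,1,2,\dots,$$ with a fixed choice of the sign $\pm$. If $\xi_1=\pm1$ and $\xi_2=1$, then, for $x^0$ sufficiently close to $x^*$, the sequence $\{x^k\}$ converges to $x^*$ with order three.
   Context: Let $M\in\mathbb{R}^{n\times n}$, $q\in\mathbb{R}^n$, and $m(\cdot):\mathbb{R}^n\to\mathbb{R}^n$ be a mapping such that $g(z)=z-m(z)$ is an invertible function on $\mathbb{R}^n$. Let $\alpha,\beta>0$ be constants, $I$ the $n\times n$ identity matrix, $\Omega=\alpha I$, $A=\beta M$, and let $c$ be a large positive integer. Absolute values, squares, square roots and addition of the scalar $e^{-c}$ are applied to vectors componentwise; thus $(x^2+e^{-c})^{1/2}=\big((x_1^2+e^{-c})^{1/2},\dots,(x_n^2+e^{-c})^{1/2}\big)^{T}$. Define $$F_c(x)=(\Omega+A)x-(\Omega-A)\,(x^2+e^{-c})^{1/2}+M\,m(z)+q,\qquad z=g^{-1}\big(\beta(|x|+x)\big).$$ (This smooths the fixed-point form of the implicit complementarity problem $z-m(z)\ge 0$, $w=Mz+q\ge 0$, $(z-m(z))^T(Mz+q)=0$.) $F_c$ is taken to be smooth, and $F_c'(x)$ denotes its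 Jacobian matrix. The iteration formula presupposes that $F_c'$ is invertible at the points where its inverse is used. Convergence to $x^*$ with order $p$ means $x^k\to x^*$ and $\|x^{k+1}-x^*\|=O(\|x^k-x^*\|^p)$.
   Formalization: The Jacobian F_c'(x* ) is additionally assumed invertible; without this, F_c can have a double root at x* (e.g. n=1, m=0, M=-1, α=β=1, q=2e^{-c/2}, x*=0) and convergence is only linear. Invertibility of F_c' at all iterates is then proved. *)

(* Defs.v *)
From HB Require Import structures.
From mathcomp Require Import all_boot all_order all_algebra.
From mathcomp Require Import all_classical all_reals all_analysis.
Import Order.TTheory GRing.Theory Num.Theory.
Import numFieldNormedType.Exports.

Set Implicit Arguments.
Unset Strict Implicit.
Unset Printing Implicit Defensive.

Local Open Scope classical_set_scope.
Local Open Scope ring_scope.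

(* f is C^(k+1) iff it is Frechet differentiable everywhere and all its
   directional derivatives are C^k; in finite dimension the latter says that
   x |-> 'd f x is C^k. *)
Fixpoint Ck (R : realType) (U V : normedModType R) (k : nat) (f : U -> V) :
    Prop :=
  match k with
  | 0 => continuous f
  | k'.+1 => (forall x, differentiable f x) /\
             (forall v, Ck k' (fun x => 'D_v f x))
  end.

Definition smooth (R : realType) (U V : normedModType R) (f : U -> V) : Prop :=
  forall k, Ck k f.

(* The library's [jacobian] is for row vectors (acting on the right); this is
   the usual Jacobian (d f_i / d x_j) of a map between column vectors. *)
Definition cjacobian (R : realType) (m n : nat) (f : 'cV[R]_n -> 'cV[R]_m)
    (x : 'cV[R]_n) : 'M[R]_(m, n) :=
  \matrix_(i < m, j < n) ('d f x (delta_mx j ord0)) i ord0.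

(* [ginv] stands for the inverse of z |-> z - mm z. *)
Definition Fc (R : realType) (n : nat) (M : 'M[R]_n) (q : 'cV[R]_n)
    (mm ginv : 'cV[R]_n -> 'cV[R]_n) (alpha beta : R) (c : nat)
    (x : 'cV[R]_n) : 'cV[R]_n :=
  let Omega : 'M[R]_n := alpha%:M in
  let A : 'M[R]_n := beta *: M in
  let absx : 'cV[R]_n := map_mx (fun t : R => `|t|) x in
  let sqrtx : 'cV[R]_n :=
    map_mx (fun t : R => Num.sqrt (t ^+ 2 + expR (- c%:R))) x in
  let z := ginv (beta *: (absx + x)) in
  (Omega + A) *m x - (Omega - A) *m sqrtx + M *m mm z + q.

(* [sgn] is the sign (1 or -1) chosen in the first substep. *)
Definition two_step_iteration (R : realType) (n : nat)
    (F : 'cV[R]_n -> 'cV[R]_n) (sgn xi1 xi2 : R) (x y : nat -> 'cV[R]_n) :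
    Prop :=
  forall k : nat,
    y k = x k + (sgn * xi1) *: (invmx (cjacobian F (x k)) *m F (x k)) /\
    x k.+1 = y k - xi2 *: (invmx (cjacobian F (x k)) *m F (y k)).

(* The norm is the sup norm of 'cV[R]_n; since all norms are equivalent in
   finite dimension, neither conjunct depends on this choice. *)
Definition converges_with_order (R : realType) (n : nat) (p : nat)
    (x : nat -> 'cV[R]_n) (xs : 'cV[R]_n) : Prop :=
  x @ \oo --> xs /\
  (fun k => x k.+1 - xs) =O_\oo (fun k => `|x k - xs| ^+ p).

(* Main.v *)
(* Write e = x - x*, J = F'(x), N = J^-1 F(x), s = +-1 for the sign of the first
   substep and B(v) = D_v D_v F(x).  Taylor's formula at x, applied to the
   displacements -e and sN, gives
     0 = F(x) - Je + B(e)/2 + O(|e|^3),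
     F(y) = F(x) + sJN + B(N)/2 + O(|N|^3),
   where B(sN) = B(N) since s^2 = 1.  The first line gives e - N = O(|e|^2), and
   subtracting the two gives
     y - J^-1 F(y) - x* = J^-1 (B(e) - B(N)) / 2 + O(|e|^3) = O(|e|^3),
   because B is quadratic; the value of s has cancelled. *)

Require Import Defs.
From HB Require Import structures.
From mathcomp Require Import all_boot all_order all_algebra.
From mathcomp Require Import all_classical all_reals all_analysis.
From mathcomp Require Import ring lra.
Import Order.TTheory GRing.Theory Num.Theory.
Import numFieldNormedType.Exports.

Set Implicit Arguments.
Unset Strict Implicit.
Unset Printing Implicit Defensive.

Local Open Scope classical_set_scope.
Local Open Scope ring_scope.

(** * Sup norm of matrices and columns *)

Section matrix_norm.
Context {R : realType}.

Lemma ler_norm_coord m n (A : 'M[R]_(m, n)) i j : `|A i j| <= `|A|.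
Proof.
rewrite [leRHS]/Num.Def.normr/= mx_normrE.
exact: (le_bigmax _ (fun ij : 'I_m * 'I_n => `|A ij.1 ij.2|) (i, j)).
Qed.

Lemma mx_norm_le m n (A : 'M[R]_(m, n)) K :
  0 <= K -> (forall i j, `|A i j| <= K) -> `|A| <= K.
Proof.
by move=> K0 AK; rewrite [leLHS]/Num.Def.normr/= mx_normrE bigmax_le.
Qed.

Lemma mulmx_norm_le m n (A : 'M[R]_(m, n)) :
  exists2 k, 0 < k & forall v : 'cV[R]_n, `|A *m v| <= k * `|v|.
Proof.
(* The sum over all entries dominates each row sum; the added 1 keeps [k] positive even when [A] is
   zero. *)
exists (1 + \sum_i \sum_j `|A i j|) => [|v].
  by rewrite ltr_pwDl// sumr_ge0// => i _; rewrite sumr_ge0.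
apply: mx_norm_le => [|i j].
  by rewrite mulr_ge0// addr_ge0// sumr_ge0// => i _; rewrite sumr_ge0.
rewrite mxE (le_trans (ler_norm_sum _ _ _))//.
apply: (@le_trans _ _ ((\sum_j `|A i j|) * `|v|)).
  rewrite mulr_suml ler_sum// => k _.
  by rewrite normrM ler_wpM2l// ler_norm_coord.
rewrite ler_wpM2r// (bigD1 i)//= addrCA lerDl addr_ge0// sumr_ge0// => k _.
by rewrite sumr_ge0.
Qed.

Lemma cvec_sum_delta n (v : 'cV[R]_n) : v = \sum_j v j 0 *: delta_mx j 0.
Proof.
rewrite {1}[v]matrix_sum_delta; apply: eq_bigr => j _.
by rewrite big_ord1.
Qed.

End matrix_norm.

(** * One-variable Taylor estimate and restriction to lines *)

Section taylor.
Context {R : realType}.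

(** By the mean value theorem [f t = df c * t] for some [c] in [0, t], and [c ^+ k <= t ^+ k]; the
    factor 1/(k+1) of an integration is given up. *)
Lemma growth_from0 (f df : R -> R) (K : R) (k : nat) :
  (forall t : R, is_derive t 1 f (df t)) -> f 0 = 0 ->
  (forall t : R, 0 <= t <= 1 -> `|df t| <= K * t ^+ k) ->
  forall t, 0 <= t <= 1 -> `|f t| <= K * t ^+ k.+1.
Proof.
move=> fdf f0 dfK t /andP[t0 t1].
have K0 : 0 <= K.
  have := dfK 1; rewrite ler01 lexx expr1n mulr1 => /(_ isT).
  exact: le_trans.
have [|c] := @MVT_segment R f df 0 t t0 (fun x _ => fdf x).
  apply: derivable_within_continuous => x _.
  by have dfx := fdf x; exact: ex_derive.
rewrite in_itv/= f0 !subr0 => /andP[c0 ct] ->.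
rewrite normrM (ger0_norm t0) exprSr mulrA ler_wpM2r//.
rewrite (le_trans (dfK c _)) ?c0 ?(le_trans ct)//.
by rewrite ler_wpM2l// lerXn2r.
Qed.

Lemma taylor2_remainder (f0 f1 f2 f3 : R -> R) (K : R) :
  (forall t : R, is_derive t 1 f0 (f1 t)) ->
  (forall t : R, is_derive t 1 f1 (f2 t)) ->
  (forall t : R, is_derive t 1 f2 (f3 t)) ->
  (forall t : R, 0 <= t <= 1 -> `|f3 t| <= K) ->
  `|f0 1 - f0 0 - f1 0 - 2^-1 * f2 0| <= K.
Proof.
move=> d01 d12 d23 f3K.
(* [g2], [g1], [g0] are the Taylor remainders at 0 of [f2], [f1], [f0]. All vanish at 0, and their
   derivatives are [f3], [g2], [g1], so three uses of [growth_from0] lead from [f3] to [g0]. *)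
pose g2 t := f2 t - f2 0.
pose g1 t := f1 t - f1 0 - t * f2 0.
pose g0 t := f0 t - f0 0 - t * f1 0 - 2^-1 * t ^+ 2 * f2 0.
have did (t : R) : is_derive t 1 id 1 by exact: is_derive_id.
have e3 (t : R) : is_derive t 1 g2 (f3 t).
  rewrite /g2; apply: is_derive_eq; by rewrite subr0.
have e2 (t : R) : is_derive t 1 g1 (g2 t).
  rewrite /g1 /g2; apply: is_derive_eq.
  by rewrite subr0 scaler0 add0r /GRing.scale/= mulr1.
have e1 (t : R) : is_derive t 1 g0 (g1 t).
  rewrite /g1 /g0; apply: is_derive_eq.
  rewrite /GRing.scale/=; field; exact: isT.
have b2 := @growth_from0 _ _ K 0 e3 (subrr _).
have b1 := @growth_from0 _ _ K 1 e2.
have b0 := @growth_from0 _ _ K 2 e1.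
have -> : f0 1 - f0 0 - f1 0 - 2^-1 * f2 0 = g0 1.
  by rewrite /g0 mul1r expr1n mulr1.
rewrite -[leRHS]mulr1 -[X in K * X](expr1n _ 3).
apply: b0; last by rewrite ler01 lexx.
  by rewrite /g0 expr0n mulr0 !mul0r !subr0 subrr.
apply: b1; first by rewrite /g1 mul0r subr0 subrr.
by apply: b2 => t t01; rewrite mulr1 f3K.
Qed.

Lemma is_derive_line (V W : normedModType R) (G : V -> W) x d t :
  derivable G (x + t *: d) d ->
  is_derive t 1 (fun s => G (x + s *: d)) ('D_d G (x + t *: d)).
Proof.
(* Both difference quotients are the same function of [h], so derivability and the value of the
   derivative transfer together. *)
have E : (fun h : R => h^-1 *: (G (x + (h *: 1 + t) *: d) - G (x + t *: d))) =
         (fun h => h^-1 *: (G (h *: d + (x + t *: d)) - G (x + t *: d))).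
  apply/funext => h; congr (_ *: (G _ - _)).
  by rewrite [h *: 1]mulr1 scalerDl addrCA.
by move=> dG; split; rewrite /derivable /derive E.
Qed.

Lemma is_derive_line_coord (V : normedModType R) m n (G : V -> 'M[R]_(m, n))
    x d t i j : differentiable G (x + t *: d) ->
  is_derive t 1 (fun s => G (x + s *: d) i j) ('D_d G (x + t *: d) i j).
Proof.
move=> /(@diff_derivable _ _ _ _ _ d)/is_derive_line[dG EG].
split; first exact: ((derivable_mxP _ _ _).1 dG i j).
by rewrite -EG derive_mx// mxE.
Qed.

End taylor.

(** * Iterated directional derivatives and their local bounds *)

Fixpoint iterD (R : realType) (V W : normedModType R) (vs : seq V)
    (F : V -> W) : V -> W :=
  if vs is v :: vs' then iterD vs' (fun x => 'D_v F x) else F.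

Section iterated_derivatives.
Context {R : realType}.

Lemma Ck_differentiable {V W : normedModType R} k (F : V -> W) x :
  Ck k.+1 F -> differentiable F x.
Proof. by move=> [+ _]; apply. Qed.

Lemma Ck_derive {V W : normedModType R} k (F : V -> W) v :
  Ck k.+1 F -> Ck k (fun x => 'D_v F x).
Proof. by move=> [_]; apply. Qed.

(** Pulls the coordinates of one direction out of the differentiations still to come; [Ck (size vs)]
    supplies one derivative per direction. *)
Lemma iterD_sum {V W : normedModType R} n vs (a : 'I_n -> R)
    (G : 'I_n -> V -> W) :
  (forall j, Ck (size vs) (G j)) ->
  iterD vs (fun x => \sum_j a j *: G j x) =
  (fun x => \sum_j a j *: iterD vs (G j) x).
Proof.
elim: vs G => // v vs IH G CG /=.
rewrite -IH => [|j]; last exact: Ck_derive.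
congr (iterD vs _); apply/funext => x.
have -> : (fun x => \sum_j a j *: G j x) = \sum_j (a j \*: G j).
  by apply/funext => z; rewrite fct_sumE.
have dG j : derivable (G j) x v.
  by apply/diff_derivable; exact: Ck_differentiable (CG j).
rewrite derive_sum => [|j]; last exact: derivableZ.
by apply: eq_bigr => j _; rewrite deriveZ.
Qed.

Lemma derive_coordE {W : normedModType R} n (F : 'cV[R]_n -> W)
    (x v : 'cV[R]_n) :
  differentiable F x ->
  'D_v F x = \sum_j v j 0 *: 'D_(delta_mx j 0) F x.
Proof.
move=> dF; rewrite deriveE// {1}(cvec_sum_delta v) linear_sum.
by apply: eq_bigr => j _; rewrite linearZ deriveE.
Qed.

(** Induction on [k]: expanding the first direction in the standard basis leaves finitely many maps
    ['D_(delta_mx j 0) F], and each coordinate of [v] is at most its norm. One neighbourhood thus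
    serves all directions at once. *)
Lemma iterD_bound {W : normedModType R} n k (F : 'cV[R]_n -> W)
    (xs : 'cV[R]_n) :
  Ck k F ->
  exists2 K : R, 0 <= K & \forall x \near xs, forall vs, size vs = k ->
    `|iterD vs F x| <= K * \prod_(v <- vs) `|v|.
Proof.
elim: k F => [F cF|k IH F CF].
  exists (`|F xs| + 1); first by rewrite addr_ge0.
  have : \forall x \near xs, `|F x| <= `|F xs| + 1.
    by apply: cvgr_norm_le (cF xs) _ _; rewrite ltrDl.
  apply: filterS => x Fx [] // _.
  by rewrite big_nil mulr1.
have /choice[K HK] j : exists K : R, 0 <= K /\
    \forall x \near xs, forall vs, size vs = k ->
    `|iterD vs (fun x => 'D_(delta_mx j 0) F x) x| <= K * \prod_(v <- vs) `|v|.
  by have [K K0 FK] := IH _ (Ck_derive (delta_mx j 0) CF); exists K.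
exists (\sum_j K j); first by rewrite sumr_ge0// => j _; case: (HK j).
have : \forall x \near xs, forall j vs, size vs = k ->
    `|iterD vs (fun x => 'D_(delta_mx j 0) F x) x|
      <= K j * \prod_(v <- vs) `|v|.
  by apply: (@filter_forall _ _ _ _ (nbhs_filter xs)) => j; case: (HK j).
apply: filterS => x Kx [//|v vs] [svs] /=.
have -> : (fun x => 'D_v F x) =
    (fun x => \sum_j v j 0 *: 'D_(delta_mx j 0) F x).
  by apply/funext => z; apply: derive_coordE; exact: Ck_differentiable CF.
rewrite (iterD_sum (fun j => v j 0)) => [|j]; last first.
  by rewrite svs; exact: Ck_derive.
rewrite (le_trans (ler_norm_sum _ _ _))// mulr_suml ler_sum// => j _.
by rewrite normrZ big_cons mulrCA ler_pM// ?ler_norm_coord// Kx.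
Qed.

End iterated_derivatives.

(** * The second derivative as a quadratic form *)

Section second_derivative.
Context {R : realType} {V W : normedModType R}.
Variables (F : V -> W) (x : V).
Hypothesis CF : Ck 2 F.

Lemma deriveBv (G : V -> W) z u v : differentiable G z ->
  'D_(u - v) G z = 'D_u G z - 'D_v G z.
Proof. by move=> dG; rewrite !deriveE// linearB. Qed.

(** Subtract and add D_v D_u F. Both resulting terms carry the direction [u - v], which gains one
    order when [u = e] and [v = N]. *)
Lemma derive2_diag_sub u v :
  'D_u (fun z => 'D_u F z) x - 'D_v (fun z => 'D_v F z) x =
  'D_(u - v) (fun z => 'D_u F z) x + 'D_v (fun z => 'D_(u - v) F z) x.
Proof.
have dD w : differentiable (fun z => 'D_w F z) x.
  exact: Ck_differentiable (Ck_derive w CF).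
rewrite deriveBv//.
have -> : (fun z => 'D_(u - v) F z) =
    (fun z => 'D_u F z) - (fun z => 'D_v F z).
  by apply/funext => z; apply: deriveBv; exact: Ck_differentiable CF.
by rewrite deriveB; [rewrite addrA subrK|exact: diff_derivable..].
Qed.

Lemma derive2_diag_scale a v :
  'D_(a *: v) (fun z => 'D_(a *: v) F z) x =
  a ^+ 2 *: 'D_v (fun z => 'D_v F z) x.
Proof.
have dD w : differentiable (fun z => 'D_w F z) x.
  exact: Ck_differentiable (Ck_derive w CF).
rewrite deriveE// linearZZ -deriveE//.
have -> : (fun z => 'D_(a *: v) F z) = a \*: (fun z => 'D_v F z).
  apply/funext => z /=.
  by rewrite !deriveE ?linearZ//; exact: Ck_differentiable CF.
rewrite deriveZ; last exact: diff_derivable.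
by rewrite scalerA -expr2.
Qed.

End second_derivative.

(** * Second-order Taylor formula for matrix-valued maps *)

Lemma taylor2_mx (R : realType) (V : normedModType R) m n
    (F : V -> 'M[R]_(m, n)) x d K : Ck 3 F -> 0 <= K ->
  (forall t : R, 0 <= t <= 1 -> `|iterD [:: d; d; d] F (x + t *: d)| <= K) ->
  `|F (x + d) - F x - 'D_d F x - 2^-1 *: 'D_d (fun z => 'D_d F z) x| <= K.
Proof.
(* The sup norm reduces the bound to single entries, where the scalar formula applies to
   [t |-> F (x + t *: d) i j]. *)
move=> CF K0 FK; apply: mx_norm_le => // i j.
have C2 := Ck_derive d CF; have C1 := Ck_derive d C2.
rewrite !mxE.
have := @taylor2_remainder _ _ _ _ _ K
  (fun t => is_derive_line_coord i j (Ck_differentiable (x + t *: d) CF))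
  (fun t => is_derive_line_coord i j (Ck_differentiable (x + t *: d) C2))
  (fun t => is_derive_line_coord i j (Ck_differentiable (x + t *: d) C1)).
rewrite scale1r scale0r addr0; apply => t t01.
exact: le_trans (ler_norm_coord _ _ _) (FK t t01).
Qed.

(** * Jacobian matrices and their inverses near a point *)

Section jacobian.
Context {R : realType}.

Lemma cjacobianE m n (F : 'cV[R]_n -> 'cV[R]_m) (x v : 'cV[R]_n) :
  differentiable F x -> cjacobian F x *m v = 'D_v F x.
Proof.
move=> dF; rewrite derive_coordE//; apply/matrixP => i j.
rewrite !mxE summxE; apply: eq_bigr => k _.
by rewrite !mxE deriveE// mulrC !ord1.
Qed.

Lemma derive_near m n (F : 'cV[R]_n -> 'cV[R]_m) (xs : 'cV[R]_n)
    (e : R) : Ck 1 F -> 0 < e ->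
  \forall x \near xs, forall v, `|'D_v F x - 'D_v F xs| <= e * `|v|.
Proof.
move=> CF e0.
(* Each of the [n] coordinates contributes at most [e / n.+1] times [|v|]; [n.+1] is nonzero even
   for [n = 0]. *)
have : \forall x \near xs, forall j : 'I_n,
    `|'D_(delta_mx j 0) F xs - 'D_(delta_mx j 0) F x| <= e / n.+1%:R.
  apply: (@filter_forall _ _ _ _ (nbhs_filter xs)) => j.
  have /cvgrPdist_le := Ck_derive (delta_mx j 0) CF xs.
  by apply; rewrite divr_gt0.
apply: filterS => x Hx v.
have dF z : differentiable F z by exact: Ck_differentiable CF.
rewrite !derive_coordE// -sumrB (le_trans (ler_norm_sum _ _ _))//.
apply: (@le_trans _ _ (\sum_(j < n) (e / n.+1%:R * `|v|))).
  rewrite ler_sum// => j _; rewrite -scalerBr normrZ mulrC distrC.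
  by rewrite ler_pM// ler_norm_coord.
rewrite sumr_const card_ord -mulrnAl ler_wpM2r// -mulr_natr -mulrA.
by rewrite ler_piMr ?(ltW e0)// mulrC ler_pdivrMr// mul1r ler_nat.
Qed.

(** The Jacobian at [xs] stretches every vector by at least 1/k, and near [xs] it changes by at most
    1/(2k). It therefore still stretches by at least 1/(2k), which gives both injectivity and the
    bound 2k for the inverse. *)
Lemma invmx_cjacobian_near n (F : 'cV[R]_n -> 'cV[R]_n) (xs : 'cV[R]_n) :
  Ck 1 F -> cjacobian F xs \in unitmx ->
  exists2 K : R, 0 <= K & \forall x \near xs, cjacobian F x \in unitmx /\
    forall v : 'cV[R]_n, `|invmx (cjacobian F x) *m v| <= K * `|v|.
Proof.
move=> CF uJ; have [k k0 kP] := mulmx_norm_le (invmx (cjacobian F xs)).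
exists (2 * k); first by rewrite mulr_ge0// ltW.
have e0 : 0 < (2 * k)^-1 by rewrite invr_gt0 mulr_gt0.
apply: filterS (derive_near xs CF e0) => x Jx.
have lower (v : 'cV[R]_n) : `|v| <= 2 * k * `|cjacobian F x *m v|.
  have dF z : differentiable F z by exact: Ck_differentiable CF.
  have vk : `|v| <= k * `|cjacobian F xs *m v|.
    by have := kP (cjacobian F xs *m v); rewrite (mulKmx uJ).
  have := Jx v; rewrite -(cjacobianE _ (dF x)) -(cjacobianE _ (dF xs)).
  rewrite distrC => Jv.
  have := ler_normD (cjacobian F xs *m v - cjacobian F x *m v)
    (cjacobian F x *m v).
  rewrite subrK => /le_trans-/(_ _ (lerD Jv (lexx _))).
  move=> /(ler_wpM2l (ltW k0)) /(le_trans vk).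
  have -> : k * ((2 * k)^-1 * `|v| + `|cjacobian F x *m v|) =
     2^-1 * `|v| + k * `|cjacobian F x *m v|.
    by field; rewrite gt_eqF.
  by rewrite -mulrA; move: `|v| (k * _) => a b; lra.
have uJx : cjacobian F x \in unitmx.
  (* Row freeness concerns left kernels, so [lower] is applied to the transpose of a left kernel
     vector of the transposed Jacobian. *)
  rewrite -unitmx_tr -row_free_unit; apply: inj_row_free => v vJ.
  apply/eqP; rewrite -trmx_eq0 -normr_le0 (le_trans (lower _))//.
  by rewrite -[X in X *m _]trmxK -trmx_mul vJ trmx0 normr0 mulr0.
split=> [|v]; first exact: uJx.
by have := lower (invmx (cjacobian F x) *m v); rewrite (mulKVmx uJx).
Qed.

End jacobian.

(** * Estimates uniform in a neighbourhood of the solution *)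

Lemma CkW (R : realType) (V W : normedModType R) k (F : V -> W) :
  Ck k.+1 F -> Ck k F.
Proof.
elim: k F => [|k IH] F [dF CF].
  by move=> x; exact: differentiable_continuous.
by split=> // v; apply: IH; exact: CF.
Qed.

(** The expansion is made at the moving iterate [x], so [K] must not depend on it. The condition on
    [r] keeps the segment from [x] to [x + a *: d] in a ball where the third derivatives are
    bounded. *)
Lemma taylor2_near (R : realType) m n (F : 'cV[R]_n -> 'cV[R]_m)
    (xs : 'cV[R]_n) : Ck 3 F ->
  exists2 K : R, 0 <= K & exists2 r : R, 0 < r & forall x (a : R) d,
    a ^+ 2 = 1 -> `|x - xs| + `|d| < r ->
    `|F (x + a *: d) - F x - a *: (cjacobian F x *m d)
      - 2^-1 *: 'D_d (fun z => 'D_d F z) x| <= K * `|d| ^+ 3.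
Proof.
move=> CF; have [K K0 FK] := iterD_bound xs CF.
exists K => //; have /nbhs_ballP[r /= r0 rK] := FK.
exists r => // x a d a2 xdr.
have a1 : `|a| = 1 by apply/eqP; rewrite -sqr_norm_eq1 a2.
(* As [a ^+ 2 = 1], the quadratic term is the same for [d] and [a *: d]. *)
have -> : 'D_d (fun z => 'D_d F z) x = 'D_(a *: d) (fun z => 'D_(a *: d) F z) x.
  have CF2 : Ck 2 F := CkW CF.
  have scaleE := derive2_diag_scale x CF2 a d.
  rewrite a2 scale1r in scaleE.
  exact: esym scaleE.
rewrite scalemxAr (cjacobianE _ (Ck_differentiable x CF)).
apply: (taylor2_mx CF) => [|t /andP[t0 t1]].
  by rewrite mulr_ge0// exprn_ge0.
have := rK (x + t *: (a *: d)) _ [:: a *: d; a *: d; a *: d] erefl.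
rewrite !big_cons big_nil normrZ a1 mul1r mulr1 -expr2 -exprS; apply.
rewrite -ball_normE/= distrC addrAC (le_lt_trans (ler_normD _ _))//.
by rewrite (le_lt_trans _ xdr)// lerD2l !normrZ a1 mul1r ger0_norm// ler_piMl.
Qed.

Lemma derive2_near (R : realType) m n (F : 'cV[R]_n -> 'cV[R]_m)
    (xs : 'cV[R]_n) : Ck 2 F ->
  exists2 K : R, 0 <= K & \forall x \near xs, forall u v,
    `|'D_u (fun z => 'D_v F z) x| <= K * (`|u| * `|v|).
Proof.
move=> CF; have [K K0 FK] := iterD_bound xs CF.
exists K => //; apply: filterS FK => x Kx u v.
(* The head of the list is the innermost direction. *)
have := Kx [:: v; u] erefl.
by rewrite !big_cons big_nil mulr1 [X in K * X]mulrC.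
Qed.

(** * Cubic error of a single step *)

Lemma two_step_cubic (R : realType) n (F : 'cV[R]_n -> 'cV[R]_n)
    (xs : 'cV[R]_n) (s : R) :
  Ck 3 F -> s ^+ 2 = 1 -> F xs = 0 -> cjacobian F xs \in unitmx ->
  exists2 C : R, 0 <= C & \forall x \near xs, cjacobian F x \in unitmx /\
    forall y, y = x + s *: (invmx (cjacobian F x) *m F x) ->
    `|y - invmx (cjacobian F x) *m F y - xs| <= C * `|x - xs| ^+ 3.
Proof.
move=> CF s2 Fxs uJ.
have CF2 := CkW CF; have CF1 := CkW CF2.
have [K1 K10 invJ] := invmx_cjacobian_near CF1 uJ.
have [K2 K20 D2] := derive2_near xs CF2.
have [K3 K30 [r r0 T3]] := taylor2_near xs CF.
(* For [|e| <= 1] these will give [|e - N| <= C1 * |e| ^+ 2] and [|N| <= L * |e|]. *)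
pose C1 := K1 * (K2 + K3); pose L := 1 + C1.
have C10 : 0 <= C1 by rewrite mulr_ge0// addr_ge0.
have L1 : 1 <= L by rewrite lerDl.
have L0 : 0 <= L := le_trans ler01 L1.
(* [K1] bounds the inverse Jacobian; the four terms bound, in order, the two parts of B(e) - B(N),
   then [R1] and [R2]. *)
exists (K1 * (K2 * C1 + K2 * C1 * L + K3 + K3 * L ^+ 3)).
  by rewrite !(mulr_ge0, addr_ge0)// exprn_ge0.
(* The bound 1 absorbs higher powers of [|e|]; since [L >= 1], the bound [r / (1 + L)] admits both
   displacements in [T3]. *)
have small : \forall x \near xs, `|x - xs| < Num.min 1 (r / (1 + L)).
  apply/nbhs_ballP; exists (Num.min 1 (r / (1 + L))) => /=.
    by rewrite lt_min ltr01 divr_gt0// ltr_pwDl.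
  by move=> x; rewrite -ball_normE/= distrC.
apply: filterS3 invJ D2 small => x [uJx Jx] D2x.
rewrite lt_min ltr_pdivlMr ?ltr_pwDl// => /andP[/ltW e1 er].
split=> [|y yE]; first exact: uJx.
set e := x - xs in e1 er *; set J := cjacobian F x in uJx Jx yE *.
set N := invmx J *m F x in yE.
pose B u := 'D_u (fun z => 'D_u F z) x.
(* Taylor remainders for the displacement [-e], which leads to [xs], and [s *: N], which leads to
   [y]. *)
pose R1 := F xs - F x + J *m e - 2^-1 *: B e.
pose R2 := F y - F x - s *: (J *m N) - 2^-1 *: B N.
have R1le : `|R1| <= K3 * `|e| ^+ 3.
  have := T3 x (-1) e; rewrite sqrrN expr1n => /(_ erefl).
  rewrite !scaleN1r opprK -/J /e subKr; apply.
  by rewrite (le_lt_trans _ er)// mulrDr mulr1 lerD2l ler_peMr.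
have eN : e - N = invmx J *m (R1 + 2^-1 *: B e).
  by rewrite /R1 subrK Fxs sub0r mulmxDr mulmxN (mulKmx uJx) addrC.
have eNle : `|e - N| <= C1 * `|e| ^+ 2.
  rewrite eN (le_trans (Jx _))// /C1 -mulrA ler_wpM2l// addrC mulrDl.
  rewrite (le_trans (ler_normD _ _))// lerD//.
    rewrite normrZ ger0_norm// (le_trans _ (D2x e e))// ler_piMl//.
    by rewrite invf_le1// ler1n.
  by rewrite (le_trans R1le)// ler_wpM2l// [leRHS]expr2 exprS expr2 ler_piMl.
have Nle : `|N| <= L * `|e|.
  have -> : N = e - (e - N) by rewrite subKr.
  rewrite (le_trans (ler_normB _ _))// mulrDl mul1r lerD2l.
  by rewrite (le_trans eNle)// ler_wpM2l// expr2 ler_piMl.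
have R2le : `|R2| <= K3 * (L ^+ 3 * `|e| ^+ 3).
  have := T3 x s N s2; rewrite -yE -/J => /(_ _)/le_trans; apply.
    by rewrite (le_lt_trans _ er)// mulrDr mulr1 lerD2l mulrC.
  by rewrite ler_wpM2l// -exprMn lerXn2r ?nnegrE ?mulr_ge0.
have step : y - invmx J *m F y - xs =
    invmx J *m (2^-1 *: (B e - B N) + R1 - R2).
  (* [F x] cancels and [F xs] is 0; applying [invmx J] then gives [e + s *: N - invmx J *m F y],
     where [e + s *: N = y - xs]. *)
  have -> : 2^-1 *: (B e - B N) + R1 - R2 = J *m e + s *: (J *m N) - F y.
    rewrite /R1 /R2 Fxs.
    move: (B e) (B N) (J *m e) (J *m N) (F x) (F y) => b b' j j' f f'.
    by apply/matrixP => i k; rewrite !mxE; ring.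
  rewrite mulmxDr mulmxDr mulmxN (mulKmx uJx) -scalemxAr (mulKmx uJx).
  by rewrite addrAC; congr (_ - _); rewrite yE addrAC.
rewrite step (le_trans (Jx _))// -mulrA ler_wpM2l// !mulrDl.
rewrite (le_trans (ler_normB _ _))// -[K3 * L ^+ 3 * _]mulrA lerD//.
rewrite (le_trans (ler_normD _ _))// lerD//.
rewrite normrZ ger0_norm// (@le_trans _ _ `|B e - B N|)//.
  by rewrite ler_piMl// invf_le1// ler1n.
(* In each term one direction is [e - N], of order [|e| ^+ 2], and the other is [e] or [N], of order
   [|e|]. *)
rewrite /B (derive2_diag_sub _ CF2) (le_trans (ler_normD _ _))// lerD//.
  rewrite (le_trans (D2x _ _))// -mulrA ler_wpM2l//.
  by rewrite [X in _ <= _ * X]exprSr mulrA ler_wpM2r.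
have -> : K2 * C1 * L * `|e| ^+ 3 = K2 * ((L * `|e|) * (C1 * `|e| ^+ 2)).
  by ring.
by rewrite (le_trans (D2x _ _))// ler_wpM2l// ler_pM.
Qed.

(** * From the cubic error bound to convergence of order three *)

Lemma cubic_error_converges (R : realType) n (x : nat -> 'cV[R]_n)
    (xs : 'cV[R]_n) (C d : R) :
  0 <= C -> C * d ^+ 2 <= 2^-1 -> `|x 0%N - xs| < d ->
  (forall k, `|x k - xs| < d -> `|x k.+1 - xs| <= C * `|x k - xs| ^+ 3) ->
  (forall k, `|x k - xs| < d) /\ converges_with_order 3 x xs.
Proof.
move=> C0 Cd x0 step.
(* Within distance [d] of [xs], the factor [C * |x k - xs| ^+ 2] is at most 1/2. So the iterates
   stay there and a geometric sequence dominates the errors. *)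
have half k : `|x k - xs| < d -> `|x k.+1 - xs| <= 2^-1 * `|x k - xs|.
  move=> xk; rewrite (le_trans (step k xk))// exprSr mulrA ler_wpM2r//.
  rewrite (le_trans _ Cd)// ler_wpM2l// lerXn2r ?nnegrE ?(ltW xk)//.
  by rewrite ltW// (le_lt_trans _ xk).
have xd k : `|x k - xs| < d.
  elim: k => // k xk; rewrite (le_lt_trans (half k xk))// (le_lt_trans _ xk)//.
  by rewrite ler_piMl// invf_le1// ler1n.
have geo k : `|x k - xs| <= geometric d 2^-1 k.
  rewrite /geometric/=; elim: k => [|k IH]; first by rewrite mulr1 ltW.
  by rewrite (le_trans (half k (xd k)))// exprS mulrCA ler_wpM2l.
split=> //; split.
  have half1 : `|2^-1 : R| < 1 by rewrite ger0_norm// invf_lt1// ltr1n.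
  have /cvgrPdist_lt gcvg := cvg_geometric d half1.
  apply/cvgrPdist_lt => e e0; apply: filterS (gcvg e e0) => k.
  rewrite sub0r normrN distrC => /(le_lt_trans _); apply.
  by rewrite (le_trans (geo k))// ler_norm.
(* A positive constant is required, and [C] may be 0. *)
apply/eqO_exP; exists (C + 1); first by rewrite ltr_wpDl.
apply: nearW => k; rewrite (le_trans (step k (xd k)))//.
by rewrite normrX normr_id ler_wpM2r ?exprn_ge0// lerDl.
Qed.

Theorem theorem2 (R : realType) (n : nat) (M : 'M[R]_n) (q : 'cV[R]_n)
    (mm ginv : 'cV[R]_n -> 'cV[R]_n)
    (ginvK : cancel (fun z => z - mm z) ginv)
    (ginvKV : cancel ginv (fun z => z - mm z))
    (alpha beta : R) (halpha : 0 < alpha) (hbeta : 0 < beta)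
    (c : nat) (hc : (0 < c)%N)
    (hsmooth : smooth (Fc M q mm ginv alpha beta c))
    (xs : 'cV[R]_n) (hxs : Fc M q mm ginv alpha beta c xs = 0)
    (hinv : cjacobian (Fc M q mm ginv alpha beta c) xs \in unitmx)
    (sgn xi1 xi2 : R) (hsgn : sgn = 1 \/ sgn = -1)
    (hxi1 : xi1 = 1 \/ xi1 = -1) (hxi2 : xi2 = 1) :
  exists2 delta : R, 0 < delta &
    forall x y : nat -> 'cV[R]_n,
      `|x 0%N - xs| < delta ->
      two_step_iteration (Fc M q mm ginv alpha beta c) sgn xi1 xi2 x y ->
      (forall k, cjacobian (Fc M q mm ginv alpha beta c) (x k) \in unitmx) /\
      converges_with_order 3 x xs.
Proof.
move: (Fc M q mm ginv alpha beta c) hsmooth hxs hinv => F hsmooth hxs hinv.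
(* All sign choices enter through the product [sgn * xi1], itself a sign. *)
have s2 : (sgn * xi1) ^+ 2 = 1.
  by case: hsgn => ->; case: hxi1 => ->;
    rewrite !(mulrN1, mulr1, opprK, sqrrN, expr1n).
have [C C0 /nbhs_ballP[r /= r0 rC]] := two_step_cubic (hsmooth 3) s2 hxs hinv.
(* [d <= r] keeps the one-step bound valid; the other two entries give
   [C * d ^+ 2 <= C * d <= 2^-1], with [C + 1] avoiding a division by 0. *)
pose d := Num.min r (Num.min 1 (2 * (C + 1))^-1).
have C10 : 0 < 2 * (C + 1) by rewrite mulr_gt0// ltr_wpDl.
have d0 : 0 < d by rewrite !lt_min r0 ltr01 invr_gt0.
have Cd : C * d ^+ 2 <= 2^-1.
  have d1 : d <= 1 by rewrite !ge_min lexx orbT.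
  have : d <= (2 * (C + 1))^-1 by rewrite !ge_min lexx !orbT.
  rewrite -[_^-1]mul1r ler_pdivlMr// => dC.
  have : C * d ^+ 2 <= C * d by rewrite ler_wpM2l// expr2 ler_piMl// ltW.
  move: (C) (d) d0 dC => a b; lra.
exists d => [|x y x0d it]; first exact: d0.
have near_xs k : `|x k - xs| < d -> ball xs r (x k).
  by rewrite -ball_normE/= distrC => /lt_le_trans; apply; rewrite ge_min lexx.
have [|xd cvx] := @cubic_error_converges _ _ x xs C d C0 Cd x0d.
  move=> k /near_xs/rC[_ /(_ (y k))]; case: (it k) => yk ->.
  by rewrite hxi2 scale1r -yk; apply.
split=> [k|]; last exact: cvx.
by have [uJ _] := rC _ (near_xs k (xd k)); exact: uJ.
Qed.
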